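(* Let $(X,\lVert\cdot\rVert_X)$ and $(B,\lVert\cdot\rVert_B)$ be reflexive Banach spaces, let $\gamma\colon X\to B$ be a continuous linear map, and set $X_0=\gamma^{-1}(\{0\})$. Let $\rho\colon\mathbb R\to\mathbb R$ be an activation function and $(\Theta_n)_{n\in\mathbb N}$ a sequence of sets of neural network parameters such that every function $x_\theta$ represented by a neural network with activation function $\rho$ and parameters $\theta\in\Theta_n$ is a member of $X$; set $A_n=\{x_\theta\mid\theta\in\Theta_n\}\subset X$. Let $E\colon X\to(-\infty,\infty]$ be a functional, $(\lambda_n)_{n\in\mathbb N}$ a sequence of real numbers with $\lambda_n\to\infty$, $p\in(1,\infty)$ and $f\in X^*$. Define $F_n^f,F^f\colon X\to(-\infty,\infty]$ by $$F_n^f(x)=\begin{cases}E(x)+\lambda_n\lVert\gamma(x)\rVert_B^p-f(x)&\text{for }x\in A_n,\\ \infty&\text{otherwise,}\end{cases}\qquad F^f(x)=\begin{cases}E(x)-f(x)&\text{for }x\in X_0,\\ \infty&\text{otherwise.}\end{cases}$$ Assume: (i) for every $x\in X_0$ there are $x_n\in A_n$ such that $x_n\to x$ in $X$ and $\lambda_n\lVert\gamma(x_n)\rVert_B^p\to0$ as $n\to\infty$; (ii) $E$ is bounded from below, lower semi-continuous with respect to weak convergence in $(X,\lVert\cdot\rVert_X)$, and continuous with respect to the norm topology of $(X,\lVert\cdot\rVert_X)$; (iii) the sequence $(F_n^f)_{n\in\mathbb N}$ is equi-coercive with respect to $\lVert\cdot\rVert_X$. Then the sequence $(F_n^f)_{n\in\mathbb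 N}$ $\Gamma$-converges to $F^f$ (with respect to the weak topology of $X$). In particular, if $(\delta_n)_{n\in\mathbb N}$ is a sequence of non-negative real numbers converging to zero, then any sequence of $\delta_n$-quasi minimizers of $F_n^f$ is bounded and all its weak accumulation points are minimizers of $F^f$. If additionally $F^f$ possesses a unique minimizer $x^f\in X_0$, then any sequence of $\delta_n$-quasi minimizers converges to $x^f$ in the weak topology of $X$.
   Context: Neural network functions: given natural numbers $d,m,L,N_0,\dots,N_L$ with $N_0=d$, $N_L=m$, a parameter is a tuple $\theta=((A_1,b_1),\dots,(A_L,b_L))$ with matrices $A_l\in\mathbb R^{N_l\times N_{l-1}}$ and vectors $b_l\in\mathbb R^{N_l}$. Each pair induces the affine map $T_l(y)=A_ly+b_l$, and the function represented by $\theta$ with activation function $\rho\colon\mathbb R\to\mathbb R$ (applied componentwise) is $x\mapsto T_L(\rho(T_{L-1}(\rho(\cdots\rho(T_1(x))))))$. A parameter set $\Theta$ collects all parameters of this form for fixed numbers $d,m,L,N_0,\dots,N_L$. $\Gamma$-convergence: for a reflexive Banach space $X$ and $F_n,F\colon X\to(-\infty,\infty]$, $(F_n)$ is $\Gamma$-convergent to $F$ if (1) for every $x\in X$ and every $(x_n)$ with $x_n\rightharpoonup x$ one has $F(x)\le\liminf_{n\to\infty}F_n(x_n)$; and (2) for every $x\in X$ there is $(x_n)$ with $x_n\rightharpoonup x$ and $F(x)=\lim_{n\to\infty}F_n(x_n)$. $(F_n)$ is equi-coercive if $\bigcup_{n\in\mathbb N}\{x\in X\mid F_n(x)\le r\}$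 is bounded in $X$ for all $r\in\mathbb R$. A sequence $(x_n)$ in $X$ is a sequence of $\delta_n$-quasi minimizers of $(F_n)$ if $F_n(x_n)\le\inf_{x\in X}F_n(x)+\delta_n$ for all $n$.
   Formalization: Boundedness of sequences of quasi minimizers is stated only when F^f is not identically +∞; otherwise it fails, e.g. for E ≡ +∞, where every sequence is a sequence of quasi minimizers. *)

(* Defs.v *)
From HB Require Import structures.
From mathcomp Require Import all_boot all_order all_algebra.
From mathcomp Require Import all_classical all_reals all_analysis.

Set Implicit Arguments.
Unset Strict Implicit.
Unset Printing Implicit Defensive.

Import Order.TTheory GRing.Theory Num.Theory.
Import numFieldNormedType.Exports.

Local Open Scope classical_set_scope.
Local Open Scope ring_scope.

Section dual.
Context {R : realType} (X : normedModType R).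

Definition dual_pred : {pred X -> R^o} :=
  mem [set f : X -> R^o | linear f /\ continuous f].

Record dual := Dual {
  dual_fun :> X -> R^o;
  dualP : dual_fun \in dual_pred }.

HB.instance Definition _ := [isSub for dual_fun].
HB.instance Definition _ := [Choice of dual by <:].

Lemma dual_submod_closed : submod_closed dual_pred.
Proof.
split=> [|a f g /set_mem[lf cf] /set_mem[lg cg]]; apply/mem_set; split.
- by move=> a x y /=; rewrite -[RHS]/(a *: 0 + 0) scaler0 addr0.
- exact: (@cst_continuous X R^o 0).
- move=> b x y; rewrite -[LHS]/(a *: f (b *: x + y) + g (b *: x + y)).
  rewrite -[RHS]/(b *: (a *: f x + g x) + (a *: f y + g y)) lf lg.
  by rewrite !scalerDr !scalerA (mulrC b a) addrACA.
- move=> x; apply: cvgD; last exact: cg.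
  by apply: cvgZl_tmp; exact: cf.
Qed.

HB.instance Definition _ :=
  GRing.isSubmodClosed.Build _ _ dual_pred dual_submod_closed.
HB.instance Definition _ := [SubChoice_isSubLmodule of dual by <:].

Lemma dual_linear (f : dual) : linear f.
Proof. by have /set_mem[] := dualP f. Qed.

Lemma dual_continuous (f : dual) : continuous f.
Proof. by have /set_mem[] := dualP f. Qed.

HB.instance Definition _ (f : dual) :=
  GRing.isLinear.Build R X R^o _ f (dual_linear f).

Definition opnorm (f : dual) : R := sup [set `|f x| | x in [set x | `|x| <= 1]].

Lemma opnorm_has_sup (f : dual) :
  has_sup [set `|f x| | x in [set x | `|x| <= 1]].
Proof.
split; first by exists `|f 0|; exists 0 => //=; rewrite normr0.
have /linear_boundedP/pinfty_ex_gt0[M M0 fM] :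
  bounded_near f (nbhs (0 : X)).
  exact/linear_bounded_continuous/dual_continuous.
exists M => _ [x /= x1 <-]; rewrite (le_trans (fM x))//.
by rewrite -[leRHS]mulr1 ler_pM2l.
Qed.

Lemma opnorm_ub (f : dual) (x : X) : `|f x| <= opnorm f * `|x|.
Proof.
have [->|x0] := eqVneq x 0; first by rewrite linear0 !normr0 mulr0.
have nx : 0 < `|x| by rewrite normr_gt0.
have : `|f (`|x|^-1 *: x)| <= opnorm f.
  apply: sup_upper_bound; first exact: opnorm_has_sup.
  exists (`|x|^-1 *: x) => //=.
  by rewrite normrZ normfV normr_id mulVf ?gt_eqF.
by rewrite linearZ normrZ normfV normr_id mulrC ler_pdivrMr.
Qed.

Lemma opnorm_le (f : dual) (M : R) :
  (forall x, `|x| <= 1 -> `|f x| <= M) -> opnorm f <= M.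
Proof.
move=> fM; apply: ge_sup; first by case: (opnorm_has_sup f).
by move=> _ [x x1 <-]; exact: fM.
Qed.

Lemma opnorm_ge0 (f : dual) : 0 <= opnorm f.
Proof.
apply: le_trans (normr_ge0 (f 0)) _.
apply: sup_upper_bound; first exact: opnorm_has_sup.
by exists 0 => //=; rewrite normr0.
Qed.

Lemma opnormD (f g : dual) : opnorm (f + g) <= opnorm f + opnorm g.
Proof.
apply: opnorm_le => x x1; rewrite (le_trans (ler_normD (f x) (g x)))//.
by rewrite lerD// (le_trans (opnorm_ub _ _))// ler_piMr ?opnorm_ge0.
Qed.

Let opnormZ_le (a : R) (f : dual) : opnorm (a *: f) <= `|a| * opnorm f.
Proof.
apply: opnorm_le => x x1; rewrite -[(a *: f) x]/(a *: f x) normrZ ler_wpM2l//.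
by rewrite (le_trans (opnorm_ub _ _))// ler_piMr ?opnorm_ge0.
Qed.

Lemma opnormZ (a : R) (f : dual) : opnorm (a *: f) = `|a| * opnorm f.
Proof.
apply/eqP; rewrite eq_le opnormZ_le/=.
have [->|a0] := eqVneq a 0; first by rewrite normr0 mul0r opnorm_ge0.
rewrite -ler_pdivlMl ?normr_gt0// -normfV.
by rewrite (le_trans _ (opnormZ_le _ _))// scalerA mulVf// scale1r.
Qed.

Lemma opnorm0_eq0 (f : dual) : opnorm f = 0 -> f = 0.
Proof.
move=> f0; apply/val_inj/funext => x /=; apply/eqP.
by rewrite -[_ == _]/(f x == 0) -normr_le0 (le_trans (opnorm_ub f x))// f0 mul0r.
Qed.

HB.instance Definition _ := Lmodule_isNormed.Build R dual
  opnormD opnormZ opnorm0_eq0.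

End dual.

(* Surjectivity of the canonical embedding of [X] into its bidual *)
Definition reflexive_space (R : realType) (X : normedModType R) :=
  forall Phi : dual (dual X : normedModType R),
    exists x : X, forall f : dual X, Phi f = f x.

Section weak.
Context {R : realType} (X : normedModType R).

Definition dual_eval (x : X) : {ptws dual X -> R^o} := fun f => f x.

(* [X] equipped with the coarsest topology making all elements of [dual X]
   continuous *)
Definition weak : Type := initial_topology dual_eval.

HB.instance Definition _ := Topological.copy weak (initial_topology dual_eval).

End weak.

Definition weak_cvg (R : realType) (X : normedModType R) (u : nat -> X)
    (x : X) :=
  (u : nat -> weak X) @ \oo --> (x : weak X).

Definition weak_accumulation (R : realType) (X : normedModType R)
    (u : nat -> X) : set X :=
  cluster ((u : nat -> weak X) @ \oo).

Lemma weak_cvgP (R : realType) (X : normedModType R) (u : nat -> X) (x : X) :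
  weak_cvg u x <-> forall f : dual X, f (u n) @[n --> \oo] --> f x.
Proof.
rewrite /weak_cvg; split=> [ux f|ux].
  have ux' : dual_eval (u n) @[n --> \oo] --> dual_eval x.
    exact: continuous_cvg (@initial_continuous _ _ (@dual_eval R X) x) ux.
  apply: (@cvg_comp _ _ _ (fun n => dual_eval (u n))
    (@proj (dual X) (fun=> R^o) f) _ _ _ ux').
  exact: (@proj_continuous (dual X) (fun=> R^o) f (dual_eval x)).
have ux' : dual_eval (u n) @[n --> \oo] --> (dual_eval x : {ptws dual X -> R^o}).
  by apply/pointwise_cvgP => f; exact: ux.
move=> A /=; rewrite (@nbhsE (weak X)) => -[_ [[B oB <-] Bx] BA].
have : nbhs (dual_eval x : {ptws dual X -> R^o}) B by exact: open_nbhs_nbhs.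
by move=> /ux' uB; apply: (@filterS _ \oo _ _ _ _ uB) => n; exact: BA.
Qed.

(* [s] lists the widths of the hidden layers, so the depth is
   [L = (size s).+1] and the tuple (N_0, ..., N_L) is [d :: rcons s m]. *)
Fixpoint nn_param (R : Type) (d : nat) (s : seq nat) (m : nat) : Type :=
  match s with
  | [::] => ('M[R]_(m, d) * 'cV[R]_m)%type
  | k :: s' => (('M[R]_(k, d) * 'cV[R]_k) * nn_param R k s' m)%type
  end.

Definition affine (R : pzRingType) (k d : nat) (T : 'M[R]_(k, d) * 'cV[R]_k)
  (y : 'cV[R]_d) : 'cV[R]_k := T.1 *m y + T.2.

Fixpoint nn_fun (R : pzRingType) (rho : R -> R) (d : nat) (s : seq nat)
    (m : nat) : nn_param R d s m -> 'cV[R]_d -> 'cV[R]_m :=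
  match s return nn_param R d s m -> 'cV[R]_d -> 'cV[R]_m with
  | [::] => fun theta x => affine theta x
  | k :: s' => fun theta x =>
      nn_fun rho theta.2 (map_mx rho (affine theta.1 x))
  end.

(* A vector space [X] whose elements are functions from R^d to R^m, or classes
   of such functions (equal almost everywhere, or on a subset of R^d):
   [represents g x] reads "[g] is (a representative of) [x]", so that [g] is a
   member of [X] iff it represents some [x]. *)
Record function_space (R : realType) (d m : nat) (X : lmodType R) :=
  FunctionSpace {
  represents : ('cV[R]_d -> 'cV[R]_m) -> X -> Prop;
  represents_unique : forall g x y,
    represents g x -> represents g y -> x = y;
  represents_ex : forall x, exists g, represents g x;
  represents_linear : forall (a : R) g h x y,
    represents g x -> represents h y ->
    represents (a *: g + h) (a *: x + y) }.

Definition nn_class (R : realType) (d m : nat) (X : lmodType R)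
    (S : function_space d m X) (rho : R -> R) (s : seq nat)
    (Theta : set (nn_param R d s m)) : set X :=
  [set x | exists2 theta, Theta theta & represents S (nn_fun rho theta) x].

Section variational.
Context {R : realType} (X : normedModType R).
Implicit Types (Fn : nat -> X -> \bar R) (F : X -> \bar R) (u : nat -> X).
Local Open Scope ereal_scope.

Definition weak_lsc F :=
  forall x u, weak_cvg u x -> F x <= limn_einf (F \o u).

Definition bounded_below F := exists M : R, forall x, M%:E <= F x.

Definition gamma_cvg Fn F :=
  (forall x u, weak_cvg u x -> F x <= limn_einf (fun n => Fn n (u n))) /\
  (forall x, exists2 u, weak_cvg u x & Fn n (u n) @[n --> \oo] --> F x).

Definition equi_coercive Fn :=
  forall r : R, bounded_set (\bigcup_n [set x | Fn n x <= r%:E]).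

Definition quasi_minimizers Fn (delta : nat -> R) u :=
  forall n, Fn n (u n) <= ereal_inf (range (Fn n)) + (delta n)%:E.

Definition minimizer F : set X := [set x | forall y, F x <= F y].

Definition unique_minimizer F x := minimizer F x /\ minimizer F `<=` [set x].

End variational.

Section functionals.
Context {R : realType} (X B : normedModType R) (gamma : X -> B).
Local Open Scope ereal_scope.

Definition penalized (A : set X) (E : X -> \bar R) (lambda p : R)
    (f : dual X) (x : X) : \bar R :=
  if x \in A then E x + (lambda * `|gamma x| `^ p)%R%:E - (f x)%:E else +oo.

Definition limit_functional (E : X -> \bar R) (f : dual X) (x : X) : \bar R :=
  if x \in gamma @^-1` [set 0%R] then E x - (f x)%:E else +oo.

End functionals.

(* Main.v *)
Require Import Defs.
From HB Require Import structures.
From mathcomp Require Import all_boot all_order all_algebra.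
From mathcomp Require Import all_classical all_reals all_analysis.
From mathcomp Require Import lra.

(** The liminf inequality has two regimes. If [gamma x = 0], then [E] is
    sequentially weakly lower semicontinuous, [f] is weakly continuous and the
    penalty is eventually nonnegative. If [gamma x != 0], a functional norming
    [gamma x] shows that [`|gamma (u n)|] stays away from [0] along any sequence
    converging weakly to [x], so the penalty, and with it the whole functional,
    tends to [+oo] ([penalized_cvg_pinfty]). For [gamma x = 0] the strongly
    convergent sequence given by density is a recovery sequence, because [E] is
    norm continuous; for [gamma x != 0] the constant sequence [x] is one. This is
    [penalized_gamma_cvg].

    The statements on quasi-minimizers hold for every equi-coercive
    Gamma-convergent sequence on a reflexive space. Comparison with a recovery
    sequence of a point [y] gives [limsup Fn n (u n) <= F y]
    ([quasi_minimizers_le]); equi-coercivity then bounds [u], and if a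
    subsequence of [u] converges weakly to [x], the liminf inequality gives
    [F x <= F y]. The delicate point is that a weak accumulation point is
    defined through neighbourhoods, whereas Gamma-convergence speaks of
    sequences. The bridge is the Eberlein-Smulian theorem
    ([eberlein_smulian]): a weak accumulation point of a bounded sequence of a
    reflexive space is the weak limit of a reindexed sequence.

    Two ingredients make that theorem short. Reflexivity gives weak limits along
    ultrafilters directly ([reflexive_ultra_cvg]): the limits of the bounded
    scalar families [f (u t)] form a bounded functional of [f], hence evaluation
    at a point. The Hahn-Banach theorem ([hahn_banach]), proved from the fact
    that a minimal sublinear functional is linear, gives norming functionals and
    the separation of a point from a closed subspace, and thereby countably many
    functionals separating the points of the closed span of a sequence
    ([countable_separating_family]). *)

Set Implicit Arguments.
Unset Strict Implicit.
Unset Printing Implicit Defensive.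

Import Order.TTheory GRing.Theory Num.Theory.
Import numFieldNormedType.Exports.

Local Open Scope classical_set_scope.
Local Open Scope ring_scope.

(** * The Hahn-Banach theorem *)

Section hahn_banach.
Context {R : realType} (V : lmodType R).
Implicit Types (p q : V -> R) (x y z : V).

(** One inequality suffices for homogeneity, the converse following by scaling
    with [t^-1]; it is the half that passes to infima. *)
Definition sublinear q :=
  (forall x y, q (x + y) <= q x + q y) /\
  (forall (t : R) x, 0 <= t -> q (t *: x) <= t * q x).

Lemma sublinear_ge0 q x : sublinear q -> 0 <= q x + q (- x).
Proof.
move=> [qD qZ]; have q00 : 0 <= q 0.
  by have := qD 0 0; rewrite addr0 -lerBlDr subrr.
by apply: le_trans q00 _; rewrite -(subrr x); exact: qD.
Qed.

Lemma sublinear0 q : sublinear q -> q 0 = 0.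
Proof.
move=> sq; apply/eqP; rewrite eq_le; apply/andP; split.
  by have := sq.2 0 0 (lexx 0); rewrite scale0r mul0r.
by have := sublinear_ge0 0 sq; rewrite oppr0; lra.
Qed.

Lemma sublinearZ q (t : R) x : sublinear q -> 0 <= t -> q (t *: x) = t * q x.
Proof.
move=> sq; rewrite le_eqVlt => /predU1P[<-|t0].
  by rewrite scale0r mul0r sublinear0.
apply/eqP; rewrite eq_le (sq.2 _ _ (ltW t0))/= mulrC -ler_pdivlMr//.
have := sq.2 t^-1 (t *: x); rewrite invr_ge0 ltW// => /(_ isT).
by rewrite scalerA mulVf ?gt_eqF// scale1r mulrC.
Qed.

(** Sublinear functionals arise below as infima of families indexed by a chain
    of functionals, by a scaling parameter and by the points of a subspace; in each
    case the family only needs to be stable up to a change of index. *)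
Lemma inf_sublinear (I : Type) (D : set I) (a : I -> V -> R) :
    D !=set0 ->
    (forall x, has_lbound [set a i x | i in D]) ->
    (forall i j x y, D i -> D j ->
      exists2 k, D k & a k (x + y) <= a i x + a j y) ->
    (forall i (t : R) x, D i -> 0 <= t ->
      exists2 k, D k & a k (t *: x) <= t * a i x) ->
  sublinear (fun x => inf [set a i x | i in D]).
Proof.
move=> [i0 Di0] lb aD aZ.
have infle i x : D i -> inf [set a i x | i in D] <= a i x.
  by move=> Di; apply: ge_inf => //; exists i.
have infge x r : (forall i, D i -> r <= a i x) -> r <= inf [set a i x | i in D].
  move=> ra; apply: lb_le_inf; first by exists (a i0 x), i0.
  by move=> _ [i Di <-]; exact: ra.
split=> [x y|t x].
  rewrite -lerBlDr; apply: (infge _ _) => i Di; rewrite lerBlDr -lerBlDl.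
  apply: (infge _ _) => j Dj; rewrite lerBlDl.
  by have [k Dk] := aD i j x y Di Dj; apply: le_trans; exact: infle.
rewrite le_eqVlt => /predU1P[<-|t0].
  rewrite mul0r; have [k Dk] := aZ i0 0 x Di0 (lexx 0).
  by rewrite mul0r; apply: le_trans; exact: infle.
rewrite mulrC -ler_pdivrMr//; apply: (infge _ _) => i Di;
  rewrite ler_pdivrMr// mulrC.
by have [k Dk] := aZ i t x Di (ltW t0); apply: le_trans; exact: infle.
Qed.

(** Zorn's lemma for the reversed pointwise order. A chain has its pointwise
    infimum as a bound, which is finite since [q x >= - q (- x) >= - p (- x)] and
    sublinear since two members of a chain are comparable. *)
Lemma minimal_sublinear p : sublinear p ->
  exists q, [/\ sublinear q, forall x, q x <= p x &
    forall q', sublinear q' -> (forall x, q' x <= q x) -> q' = q].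
Proof.
move=> sp; pose P (q : V -> R) := sublinear q /\ forall x, q x <= p x.
pose T := {q | P q}.
pose r (s t : T) := `[< forall x, sval t x <= sval s x >].
have [| | | |[q [sq qp]] qmin] := @Zorn T r.
- by move=> t; apply/asboolP.
- move=> s t u /asboolP st /asboolP tu; apply/asboolP => x.
  exact: le_trans (tu x) (st x).
- move=> [s ?] [t ?] /asboolP/= st /asboolP/= ts; apply/eq_exist/funext => x.
  by apply/eqP; rewrite eq_le st ts.
- move=> C Ctot; have [C0|] := pselect (C !=set0); last first.
    by move=> C0; exists (exist P p (conj sp (fun x => lexx (p x)))) => s Cs;
      case: C0; exists s.
  have lbC x : has_lbound [set (sval s : V -> R) x | s in C].
    exists (- p (- x)) => _ [[s [ss sp']] Cs /= <-].
    by have := sublinear_ge0 x ss; have := sp' (- x); lra.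
  have sC : sublinear (fun x => inf [set (sval s : V -> R) x | s in C]).
    apply: inf_sublinear => //.
    - move=> s t x y Cs Ct; case: (Ctot s t Cs Ct) => /asboolP st.
        exists t => //; apply: le_trans ((svalP t).1.1 x y) _.
        by rewrite lerD2r.
      exists s => //; apply: le_trans ((svalP s).1.1 x y) _.
      by rewrite lerD2l.
    - by move=> s t x Cs t0; exists s => //; exact: (svalP s).1.2.
  have Cp x : inf [set (sval s : V -> R) x | s in C] <= p x.
    have [s Cs] := C0; apply: le_trans ((svalP s).2 x).
    by apply: ge_inf => //; exists s.
  exists (exist P _ (conj sC Cp)) => s Cs; apply/asboolP => x /=.
  by apply: ge_inf => //; exists s.
- exists q; split => // q' sq' q'q.
  have q'p x : q' x <= p x by exact: le_trans (q'q x) (qp x).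
  have := qmin (exist P q' (conj sq' q'p)).
  by move=> /(_ (asboolT q'q)) [].
Qed.

(** The functional [q' x = inf_(t >= 0) (q (x + t *: z) - t * q z)]: the choice
    [t = 0] gives [q' <= q], and [t = 1] gives the bound at [- z]. *)
Lemma sublinear_shift q z : sublinear q ->
  exists q', [/\ sublinear q', forall x, q' x <= q x & q' (- z) <= - q z].
Proof.
move=> sq; pose a (t : R) x := q (x + t *: z) - t * q z.
have lb x : has_lbound [set a t x | t in [set t | 0 <= t]].
  exists (- q (- x)) => _ [t /= t0 <-]; rewrite /a -sublinearZ//.
  by have := sq.1 (x + t *: z) (- x); rewrite addrAC subrr add0r; lra.
exists (fun x => inf [set a t x | t in [set t | 0 <= t]]); split.
- apply: inf_sublinear => //; first by exists 0 => /=.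
    move=> s t x y /= s0 t0; exists (s + t); first exact: addr_ge0.
    rewrite /a scalerDl addrACA.
    by have := sq.1 (x + s *: z) (y + t *: z); lra.
  move=> s t x /= s0 t0; exists (t * s); first exact: mulr_ge0.
  rewrite /a -scalerA -scalerDr.
  by have := sq.2 t (x + s *: z) t0; lra.
- move=> x; apply: ge_inf => //; exists 0 => //=.
  by rewrite /a scale0r addr0 mul0r subr0.
- apply: ge_inf => //; exists 1 => //=.
  by rewrite /a scale1r addNr sublinear0// mul1r sub0r.
Qed.

(** A minimal sublinear functional [h] equals each of its shifts, so that
    [h (- x) <= - h x] for all [x]; an odd sublinear functional is linear.
    Taking [h] below the shift of [p] at [z] forces [h z = p z], so no extension
    from a subspace is needed. *)
Theorem hahn_banach p z : sublinear p ->
  exists h : V -> R^o, [/\ linear h, forall x, h x <= p x & h z = p z].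
Proof.
move=> /(sublinear_shift z)[p' [sp' p'p p'z]].
have [h [sh hp' hmin]] := minimal_sublinear sp'.
have hN x : h (- x) = - h x.
  have [q' [sq' q'h q'x]] := sublinear_shift x sh.
  rewrite (hmin _ sq' q'h) in q'x.
  by apply/eqP; rewrite eq_le q'x; have := sublinear_ge0 x sh; lra.
exists h; split => [t x y|x|].
- rewrite -[RHS]/(t * h x + h y).
  have hD u v : h (u + v) = h u + h v.
    apply/eqP; rewrite eq_le sh.1.
    by have := sh.1 (- u) (- v); rewrite -opprD !hN; lra.
  rewrite hD; congr (_ + _); have [t0|t0] := leP 0 t; first exact: sublinearZ.
  rewrite -(opprK (t *: x)) hN -scaleNr sublinearZ//; last by lra.
  by rewrite mulNr opprK.
- exact: le_trans (hp' x) (p'p x).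
- apply/eqP; rewrite eq_le (le_trans (hp' z) (p'p z))/=.
  by have := hp' (- z); rewrite hN; lra.
Qed.

End hahn_banach.

(** * Continuous functionals on a normed space *)

Section functionals_on_normed_spaces.
Context {R : realType} (X : normedModType R).

Lemma dual_of_bounded (h : X -> R^o) (C : R) :
    linear h -> (forall x, `|h x| <= C * `|x|) ->
  exists g : dual X, forall x, g x = h x.
Proof.
move=> lh hC; pose H := GRing.isLinear.Build R X R^o _ h lh.
pose hl : {linear X -> R^o} := HB.pack h H.
have ch : continuous hl.
  apply: bounded_linear_continuous; apply/linear_boundedP.
  near=> r => x; apply: le_trans (hC x) _.
  by rewrite ler_wpM2r//; near: r; exact: nbhs_pinfty_ge.
by exists (@Dual R X h (mem_set (conj lh ch))).
Unshelve. all: by end_near. Qed.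

Lemma normr_sublinear : sublinear (fun x : X => `|x|).
Proof.
by split=> [|t x t0]; [exact: ler_normD | rewrite normrZ ger0_norm].
Qed.

Lemma dual_of_le_norm (h : X -> R^o) : linear h -> (forall x, h x <= `|x|) ->
  exists2 g : dual X, (forall x, g x = h x) & forall x, `|g x| <= `|x|.
Proof.
move=> lh hle; have hC x : `|h x| <= 1 * `|x|.
  have h0 : h 0 = 0.
    by have := lh (-1) 0 0; rewrite scaler0 addr0 scaleN1r addNr.
  have hN : h (- x) = - h x.
    by have := lh (-1) x 0; rewrite h0 !addr0 !scaleN1r.
  by rewrite mul1r ler_norml hle andbT lerNl -hN -(normrN x).
have [g gh] := dual_of_bounded lh hC.
by exists g => // x; rewrite gh -[leRHS]mul1r.
Qed.

Lemma norming_functional (x : X) :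
  exists2 g : dual X, (forall y, `|g y| <= `|y|) & g x = `|x|.
Proof.
have [h [lh hle hx]] := hahn_banach x normr_sublinear.
by have [g gh gle] := dual_of_le_norm lh hle; exists g => //; rewrite gh.
Qed.

Definition subspace_set (W : set X) :=
  W 0 /\ forall (a : R) x y, W x -> W y -> W (a *: x + y).

Lemma distance_sublinear (W : set X) : subspace_set W ->
  sublinear (fun x => inf [set `|x - w| | w in W]).
Proof.
move=> [W0 WL]; apply: inf_sublinear; first by exists 0.
- by move=> x; exists 0 => _ [w _ <-].
- move=> v w x y Wv Ww; exists (v + w); first by rewrite -(scale1r v); exact: WL.
  by rewrite opprD addrACA; exact: ler_normD.
- move=> w t x Ww t0; exists (t *: w).
    by rewrite -[_ *: _]addr0; exact: WL.
  by rewrite -scalerBr normrZ ger0_norm.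
Qed.

(** The Hahn-Banach theorem for the distance to [W], which vanishes on [W] and is
    positive at [z] if [z] is not in the closure of [W]. *)
Lemma subspace_approx (W : set X) (z : X) : subspace_set W ->
    (forall g : dual X, (forall w, W w -> g w = 0) -> g z = 0) ->
  forall e, 0 < e -> exists2 w, W w & `|z - w| < e.
Proof.
move=> sW gz e e0; apply: contrapT => far.
pose p x := inf [set `|x - w| | w in W].
have [W0 WL] := sW.
have ple w x : W w -> p x <= `|x - w|.
  by move=> Ww; apply: ge_inf; [exists 0 => _ [v _ <-] | exists w].
have [h [lh hp hz]] := hahn_banach z (distance_sublinear sW).
have [g gh gle] : exists2 g : dual X, (forall x, g x = h x) &
    forall x, `|g x| <= `|x|.
  apply: dual_of_le_norm => // x; apply: le_trans (hp x) _.
  by rewrite -[in leRHS](subr0 x); exact: ple.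
have gW w : W w -> g w <= 0.
  by move=> Ww; rewrite gh (le_trans (hp w))// (le_trans (ple w w Ww))//
    subrr normr0.
have : g z = 0.
  apply: gz => w Ww; apply/eqP; rewrite eq_le gW//= -oppr_le0 -linearN gW//.
  by rewrite -[- w]addr0 -scaleN1r; exact: WL.
rewrite gh hz -/(p z) => pz0.
suff : e <= p z by rewrite pz0 leNgt e0.
apply: lb_le_inf; first by exists `|z - 0|, 0.
by move=> _ [w Ww <-]; rewrite leNgt; apply/negP => zw; apply: far; exists w.
Qed.

End functionals_on_normed_spaces.

(** * Weak limits along filters *)

Section weak_limits.
Context {R : realType} (X : normedModType R).

(** A cluster point of an ultrafilter is a limit: of the preimage of a
    neighbourhood and its complement, one belongs to [U]. *)
Lemma ultra_bounded_cvg (T : Type) (U : set_system T) (a : T -> R^o) (M : R) :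
  UltraFilter U -> (forall t, `|a t| <= M) -> exists l : R^o, a t @[t --> U] --> l.
Proof.
move=> UU aM; have aI : (a t @[t --> U]) `[- M, M]%classic.
  by apply: (@filterE _ U) => t /=; rewrite in_itv/= -ler_norml.
have [l [_ cl]] := @segment_compact R (- M) M (a t @[t --> U]) _ aI.
exists l => A lA; have [//|UCA] := in_ultra_setVsetC (a @^-1` A) UU.
by have [x [CAx]] := cl (~` A) A UCA lA.
Qed.

(** Weak compactness of balls: the limits of [f (u t)] along [U], for varying [f],
    form a linear functional on the dual bounded by [M], which reflexivity
    represents by a point. *)
Lemma reflexive_ultra_cvg (T : Type) (U : set_system T) (u : T -> X) (M : R) :
    reflexive_space X -> UltraFilter U -> (forall t, `|u t| <= M) ->
  exists z, forall f : dual X, f (u t) @[t --> U] --> f z.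
Proof.
move=> Xrefl UU uM.
have M0 (f : dual X) t : `|f (u t)| <= M * `|f|.
  rewrite mulrC (le_trans (opnorm_ub f (u t)))//.
  by rewrite ler_wpM2l// opnorm_ge0.
have /choice[Phi PhiP] (f : dual X) : exists l : R^o, f (u t) @[t --> U] --> l.
  exact: ultra_bounded_cvg (M0 f).
have lPhi : linear Phi.
  move=> a f g; apply: (cvg_unique _ (PhiP (a *: f + g))) => //.
  exact: cvgD (cvgZl_tmp (PhiP f)) (PhiP g).
have PhiM (f : dual X) : `|Phi f| <= M * `|f|.
  apply: (cvgr_to_le (cvg_norm (PhiP f))); apply: nearW; exact: M0.
have [G GPhi] := dual_of_bounded lPhi PhiM.
have [z zP] := Xrefl G.
by exists z => f; rewrite -zP GPhi; exact: PhiP.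
Qed.

Lemma weak_filter_cvg (T : Type) (F : set_system T) (u : T -> X) (z : X) :
    Filter F -> (forall f : dual X, f (u t) @[t --> F] --> f z) ->
  (u : T -> weak X) @ F --> (z : weak X).
Proof.
move=> FF uz.
have uz' : dual_eval (u t) @[t --> F] --> (dual_eval z : {ptws dual X -> R^o}).
  by apply/pointwise_cvgP => f; exact: uz.
move=> A /=; rewrite (@nbhsE (weak X)) => -[_ [[B oB <-] Bz] BA].
have : nbhs (dual_eval z : {ptws dual X -> R^o}) B by exact: open_nbhs_nbhs.
by move=> /uz' uB; apply: (@filterS _ F _ _ _ _ uB) => t; exact: BA.
Qed.

Lemma weak_continuous_dual (f : dual X) :
  continuous (f : weak X -> R^o).
Proof.
move=> x.
have eval_x : dual_eval (y : X) @[y --> (x : weak X)] --> dual_eval (x : X).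
  exact: (@initial_continuous _ _ (@dual_eval R X) x).
apply: (@cvg_comp _ _ _ (fun y : weak X => dual_eval (y : X))
  (@proj (dual X) (fun=> R^o) f) _ _ _ eval_x).
exact: (@proj_continuous (dual X) (fun=> R^o) f (dual_eval x)).
Qed.

(** The points on which finitely many functionals nearly agree with [x] form a
    weak neighbourhood of [x]; accumulation at [x] is exploited through these
    neighbourhoods only. *)
Lemma weak_accumulation_frequently (u : nat -> X) (x : X) (g : nat -> dual X)
    (n N : nat) (e : R) : weak_accumulation u x -> 0 < e ->
  exists2 k, (N <= k)%N & forall i : 'I_n, `|g i x - g i (u k)| < e.
Proof.
move=> ux e0.
have uN : ((u : nat -> weak X) @ \oo) [set u k | k in [set k | (N <= k)%N]].
  by exists N => // k /= Nk; exists k.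
have nx : nbhs (x : weak X) [set y | forall i : 'I_n, `|g i x - g i y| < e].
  apply: (@filter_forall (weak X) 'I_n (fun i y => `|g i x - g i y| < e)
    (nbhs (x : weak X)) (nbhs_filter (x : weak X))) => i.
  exact: @cvgr_dist_lt R R^o (weak X) (nbhs (x : weak X)) (nbhs_filter (x : weak X))
    _ _ (@weak_continuous_dual (g i) x) e e0.
by have [_ [[k Nk <-] xk]] := ux _ _ uN nx; exists k.
Qed.

Lemma ultra_weak_accumulation (U : set_system nat) (u : nat -> X) (z : X) :
    UltraFilter U -> \oo `<=` U ->
    (forall f : dual X, f (u n) @[n --> U] --> f z) ->
  weak_accumulation u z.
Proof.
move=> UU oU uz A B uA zB.
have UA : U (u @^-1` A) by exact: oU.
have UB : U (u @^-1` B) by exact: (weak_filter_cvg _ uz zB).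
by have [n [An Bn]] := filter_ex (filterI UA UB); exists (u n).
Qed.

End weak_limits.

(** * The Eberlein-Smulian theorem *)

Section eberlein_smulian.
Context {R : realType} (X : normedModType R).

Lemma weak_accumulation_limit (u : nat -> X) (z : X) (f : dual X) (l : R^o) :
  weak_accumulation u z -> f (u n) @[n --> \oo] --> l -> f z = l.
Proof.
move=> uz fl; apply/eqP; rewrite -subr_eq0 -normr_le0; apply/ler_addgt0Pr => e e0.
rewrite add0r; have e20 : 0 < e / 2 by rewrite divr_gt0.
have [N _ Nl] := @cvgr_dist_lt R R^o _ _ _ _ _ fl _ e20.
have [k Nk /(_ ord0) zk] := weak_accumulation_frequently (fun=> f) 1 N uz e20.
have -> : f z - l = (f z - f (u k)) - (l - f (u k)) by rewrite opprB addrA subrK.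
rewrite (le_trans (ler_normB _ _))// (splitr e) lerD// ltW//; exact: Nl.
Qed.

Definition linear_comb (u : nat -> X) (n : nat) (c : nat -> R) : X :=
  \sum_(i < n) c i *: u i.

Lemma linear_comb_subspace (u : nat -> X) :
  subspace_set [set x | exists n c, x = linear_comb u n c].
Proof.
split=> [|a _ _ [m [b ->]] [n [c ->]]].
  by exists 0%N, (fun=> 0); rewrite /linear_comb big_ord0.
exists (maxn m n), (fun i => a * (if (i < m)%N then b i else 0) +
  (if (i < n)%N then c i else 0)).
have widen k d : (k <= maxn m n)%N -> linear_comb u k d =
    \sum_(i < maxn m n) (if (i < k)%N then d i else 0) *: u i.
  move=> kmn; rewrite /linear_comb (big_ord_widen _ (fun i => d i *: u i) kmn).
  rewrite big_mkcond; apply: eq_bigr => i _.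
  by case: ifP => // _; rewrite scale0r.
rewrite (widen m) ?leq_maxl// (widen n) ?leq_maxr// scaler_sumr -big_split/=.
by apply: eq_bigr => i _; rewrite scalerDl scalerA.
Qed.

Lemma linear_comb_ratr (u : nat -> X) n c e : 0 < e ->
  exists q : seq rat,
    `|linear_comb u n c - linear_comb u n (fun i => ratr q`_i)| < e.
Proof.
elim: n e => [|n IH] e e0.
  by exists [::]; rewrite /linear_comb !big_ord0 subrr normr0.
have e20 : 0 < e / 2 by rewrite divr_gt0.
have [q qe] := IH _ e20.
have u1 : 0 < `|u n| + 1 by rewrite ltr_wpDl.
have [r rP] : exists r : rat, `|c n - ratr r| <= e / 2 / (`|u n| + 1).
  have lt_c : c n - e / 2 / (`|u n| + 1) < c n + e / 2 / (`|u n| + 1).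
    by rewrite ltrD2l gtrN// divr_gt0.
  have [r] := rat_in_itvoo lt_c; rewrite in_itv/= => /andP[r1 r2].
  by exists r; rewrite ler_distlC; apply/andP; split; lra.
have [s sE] : exists s : seq rat, forall i, (i <= n)%N ->
    s`_i = if (i < n)%N then q`_i else r.
  exists (mkseq (fun i => if (i < n)%N then q`_i else r) n.+1) => i ni.
  by rewrite nth_mkseq.
exists s; rewrite /linear_comb !big_ord_recr/= sE// ltnn opprD addrACA.
have -> : \sum_(i < n) (ratr s`_i : R) *: u i = \sum_(i < n) ratr q`_i *: u i.
  by apply: eq_bigr => i _; rewrite sE ?ltn_ord// ltnW.
rewrite (le_lt_trans (ler_normD _ _))// (splitr e) ltr_leD//.
rewrite -scalerBl normrZ (le_trans (ler_wpM2r (normr_ge0 _) rP))//.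
by rewrite mulrAC ler_pdivrMr// ler_pM2l// lerDl.
Qed.

(** The hypothesis on [z] says that [z] lies in the closed span of [u]. The
    rational combinations of [u] are dense there, and one norming functional for
    each of them suffices: if [y] is close to [z] and [g] norms [y], then
    [`|y| = g y = g (y - z)] is small as soon as [g z = 0]. *)
Lemma countable_separating_family (u : nat -> X) :
  exists g : nat -> dual X, forall z,
    (forall f : dual X, (forall n, f (u n) = 0) -> f z = 0) ->
    (forall i, g i z = 0) -> z = 0.
Proof.
pose comb (nq : nat * seq rat) := linear_comb u nq.1 (fun i => ratr nq.2`_i).
have /choice[G GP] (nq : nat * seq rat) : exists g : dual X,
    (forall y, `|g y| <= `|y|) /\ g (comb nq) = `|comb nq|.
  by have [g gle gE] := norming_functional (comb nq); exists g.
exists (fun i => G (odflt (0%N, [::]) (unpickle i))) => z zspan Gz.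
apply/eqP; rewrite -normr_le0; apply/ler_addgt0Pr => e e0; rewrite add0r.
have e40 : 0 < e / 4 by rewrite divr_gt0.
have [w [n [c wE]] zw] : exists2 w, (exists n c, w = linear_comb u n c) &
    `|z - w| < e / 4.
  apply: (subspace_approx (linear_comb_subspace u)) => // f fspan.
  apply: zspan => n; apply: fspan; exists n.+1, (fun i => (i == n)%:R).
  rewrite /linear_comb big_ord_recr/= eqxx scale1r big1 ?add0r// => i _.
  by rewrite ltn_eqF// scale0r.
have [q wq] := linear_comb_ratr u n c e40; rewrite -wE in wq.
pose y := comb (n, q).
have zy : `|z - y| <= e / 2.
  rewrite -[z](subrK w) -addrA (le_trans (ler_normD _ _))//.
  by have : e / 2 = e / 4 + e / 4 by [lra]; move=> ->; rewrite lerD// ltW.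
have [Gle Gy] := GP (n, q).
have Gz0 : G (n, q) z = 0 by have := Gz (pickle (n, q)); rewrite pickleK.
have yz : `|y| <= `|z - y|.
  by rewrite -Gy distrC (le_trans _ (Gle _))// linearB/= Gz0 subr0 ler_norm.
rewrite -[z](subrK y) (le_trans (ler_normD _ _))//.
by move: zy yz; lra.
Qed.

Lemma ultra_frequently (P : set nat) : ~ (\forall n \near \oo, ~ P n) ->
  exists U, [/\ UltraFilter U, \oo `<=` U & U P].
Proof.
move=> freqP; have PF : ProperFilter (within P \oo).
  apply: Build_ProperFilter_ex => A PA; apply: contra_notP freqP => A0.
  apply: (@filterS _ \oo _ (fun n => P n -> A n)) PA => n PAn Pn.
  by apply: A0; exists n; exact: PAn.
have [U [UU oU]] := ultraFilterLemma PF.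
exists U; split => //; last by apply: oU; exact: withinT.
by move=> A oA; apply: oU; apply: (@filterS _ \oo _ A) oA => n An _.
Qed.

(** If [f (u n)] stayed away from [f x] frequently, an ultrafilter containing
    these indices would produce an accumulation point of [u] other than [x]. *)
Lemma weak_cvg_of_accumulation (u : nat -> X) (x : X) (M : R) :
    reflexive_space X -> (forall n, `|u n| <= M) ->
  weak_accumulation u `<=` [set x] -> weak_cvg u x.
Proof.
move=> Xrefl uM ux; apply/weak_cvgP => f; apply/(@cvgrPdist_lt _ R^o) => e e0.
apply: contrapT => far.
have [|U [UU oU Ufar]] := @ultra_frequently [set n | ~ (`|f x - f (u n)| < e)].
  by apply: contra_not far; apply: filterS => n /contrapT.
have [z zP] := reflexive_ultra_cvg Xrefl UU uM.
have zx : z = x by apply: ux; exact: (ultra_weak_accumulation UU oU zP).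
have near_x : U [set n | `|f x - f (u n)| < e].
  by rewrite -zx; exact: (@cvgr_dist_lt R R^o _ _ _ _ _ (zP f) _ e0).
by have [n [/= ? ?]] := filter_ex (filterI Ufar near_x).
Qed.

(** The indices [k n] are chosen so that the first [n] functionals of a countable
    separating family are almost matched; the bound [n <= k n] is enough for
    sequences to be reindexed, so [k] need not be increasing. Every accumulation
    point of [u \o k] lies, like [x], in the closed span of [u] and agrees with
    [x] on the family, hence equals [x]. *)
Theorem eberlein_smulian (u : nat -> X) (x : X) (M : R) :
    reflexive_space X -> (forall n, `|u n| <= M) -> weak_accumulation u x ->
  exists2 k : nat -> nat, (forall n, n <= k n)%N & weak_cvg (u \o k) x.
Proof.
move=> Xrefl uM ux; have [g gsep] := countable_separating_family u.
have /choice[k kP] (n : nat) : exists k, (n <= k)%N /\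
    forall i : 'I_n, `|g i x - g i (u k)| < n.+1%:R^-1.
  have [|k nk kg] := weak_accumulation_frequently g n n (e := n.+1%:R^-1) ux.
    by rewrite invr_gt0.
  by exists k.
exists k => [n|]; first by have [] := kP n.
apply: (weak_cvg_of_accumulation Xrefl (fun n => uM (k n))) => z zu.
apply/eqP; rewrite -subr_eq0; apply/eqP; apply: gsep => [f fu|i].
  rewrite linearB/=.
  have f0 (v : nat -> nat) : f (u (v n)) @[n --> \oo] --> (0 : R^o).
    by under eq_fun do rewrite fu; exact: cvg_cst.
  rewrite (weak_accumulation_limit zu (f0 k)).
  by rewrite (weak_accumulation_limit ux (f0 id)) subrr.
rewrite linearB/= (@weak_accumulation_limit _ _ _ (g i x) zu) ?subrr//.
apply/(@cvgrPdist_lt _ R^o) => e e0; near=> n.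
have [_ kg] := kP n.
have ni : (i < n)%N by near: n; exact: nbhs_infty_gt.
apply: lt_trans (kg (Ordinal ni)) _.
by near: n; exact: (near_infty_natSinv_lt (PosNum e0)).
Unshelve. all: by end_near. Qed.

End eberlein_smulian.

(** * Gamma-convergence and quasi-minimizers *)

Section gamma_convergence.
Context {R : realType}.
Local Open Scope ereal_scope.

Lemma real_between (a b : \bar R) : a < b -> exists r : R, a < r%:E < b.
Proof.
case: a b => [a| |] [b| |] //= => [ab|_|_|_].
- by exists ((a + b) / 2)%R; rewrite !lte_fin !midf_lt.
- by exists (a + 1)%R; rewrite ltry lte_fin ltrDl ltr01.
- by exists (b - 1)%R; rewrite ltNyr lte_fin gtrDl ltrN10.
- by exists 0%R; rewrite ltNyr ltry.
Qed.

Lemma le_limn_einf (v : nat -> \bar R) (a : \bar R) :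
    (forall r : R, r%:E < a -> \forall n \near \oo, r%:E <= v n) ->
  a <= limn_einf v.
Proof.
move=> vr; rewrite leNgt; apply/negP => /real_between[r /andP[vlt /vr [N _ Nr]]].
suff : r%:E <= limn_einf v by rewrite leNgt vlt.
rewrite limn_einf_lim (cvg_lim _ (@cvg_einfs_sup _ v))//.
apply: le_trans (ereal_sup_ubound _); last by exists N.
by apply: le_ereal_inf_tmp => _ [k /= Nk <-]; exact: Nr.
Qed.

Lemma lt_limn_einf (v : nat -> \bar R) (r : R) :
  r%:E < limn_einf v -> \forall n \near \oo, r%:E <= v n.
Proof.
rewrite limn_einf_lim (cvg_lim _ (@cvg_einfs_sup _ v))//.
move=> /ereal_sup_gt[_ [N _ <-] rN]; exists N => // n /= Nn.
by apply: le_trans (ltW rN) _; apply: ereal_inf_lbound; exists n.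
Qed.

Lemma infty_ge_id (k : nat -> nat) : (forall n, n <= k n)%N -> k @ \oo --> \oo.
Proof.
move=> nk; apply/cvgnyPge => N; exists N => // n /= Nn.
exact: leq_trans Nn (nk n).
Qed.

Variables (X : normedModType R) (Fn : nat -> X -> \bar R) (F : X -> \bar R).
Hypothesis FnF : gamma_cvg Fn F.

(** The sequence [u \o k] is not indexed by all of [nat], so the liminf inequality
    is applied to the sequence equal to [u] on the range of [k] and to a recovery
    sequence of [x] elsewhere, which still converges weakly to [x]. *)
Lemma gamma_liminf_subsequence (u : nat -> X) (x : X) (k : nat -> nat) (r : R) :
    (forall n, n <= k n)%N -> weak_cvg (u \o k) x -> r%:E < F x ->
  \forall n \near \oo, r%:E <= Fn (k n) (u (k n)).
Proof.
move=> nk ukx rFx; have [Finf Frec] := FnF; have [v vx _] := Frec x.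
pose w m := if `[< exists n, k n = m >] then u m else v m.
have wx : weak_cvg w x.
  apply/weak_cvgP => f; apply/(@cvgrPdist_lt _ R^o) => e e0.
  have /weak_cvgP/(_ f)/(@cvgrPdist_lt _ R^o)/(_ _ e0)[N _ Nu] := ukx.
  have /weak_cvgP/(_ f)/(@cvgrPdist_lt _ R^o)/(_ _ e0)[N' _ N'v] := vx.
  (* beyond the first N values of k, an index k n has n >= N *)
  exists (maxn (\max_(i < N) k i).+1 N') => // m /=.
  rewrite geq_max => /andP[Nm N'm].
  rewrite /w; case: asboolP => [[n knm]|_]; last exact: N'v.
  rewrite -knm; apply: Nu => /=; rewrite leqNgt; apply/negP => nN.
  by move: Nm; rewrite -knm ltnNge (leq_bigmax (Ordinal nN)).
have Fw : \forall m \near \oo, r%:E <= Fn m (w m).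
  exact: lt_limn_einf (lt_le_trans rFx (Finf x w wx)).
have Fwk : \forall n \near \oo, r%:E <= Fn (k n) (w (k n)).
  exact: (infty_ge_id nk Fw).
apply: filterS Fwk => n.
by rewrite /w; case: asboolP => // -[]; exists n.
Qed.

Lemma quasi_minimizers_le (delta : nat -> R) (u : nat -> X) (y : X) (r : R) :
    delta n @[n --> \oo] --> 0%R -> quasi_minimizers Fn delta u -> F y < r%:E ->
  \forall n \near \oo, Fn n (u n) <= r%:E.
Proof.
move=> delta0 uq /real_between[s /andP[Fys]]; rewrite lte_fin => sr.
have [v _ Fv] := FnF.2 y.
have Fvs : \forall n \near \oo, Fn n (v n) < s%:E.
  exact: (Fv [set z | z < s%:E] (open_ereal_lt' Fys)).
have rs0 : (0 < r - s)%R by rewrite subr_gt0.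
have drs : \forall n \near \oo, (delta n <= r - s)%R by exact: cvgr_le delta0 _ rs0.
near=> n; apply: le_trans (uq n) _.
have -> : r%:E = s%:E + (r - s)%:E by rewrite -EFinD addrC subrK.
rewrite leeD//; last by rewrite lee_fin; near: n.
apply: (@le_trans _ _ (Fn n (v n))); first by apply: ereal_inf_lbound; exists (v n).
by apply: ltW; near: n.
Unshelve. all: by end_near. Qed.

Lemma near_bounded (u : nat -> X) (M : R) :
  (\forall n \near \oo, (`|u n| <= M)%R) -> exists C, forall n, (`|u n| <= C)%R.
Proof.
move=> [N _ NM]; exists (Num.max M (\sum_(i < N) `|u i|)%R) => n.
rewrite le_max; have [Nn|nN] := leqP N n; first by rewrite NM.
rewrite orbC (bigD1 (Ordinal nN))//= lerDl sumr_ge0//.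
Qed.

Lemma quasi_minimizers_bounded (delta : nat -> R) (u : nat -> X) (y : X) :
    equi_coercive Fn -> delta n @[n --> \oo] --> 0%R ->
    quasi_minimizers Fn delta u -> F y < +oo ->
  exists M : R, forall n, (`|u n| <= M)%R.
Proof.
move=> Fcoer delta0 uq /real_between[r /andP[Fyr _]].
have [M [_ MF]] := Fcoer r.
apply: (@near_bounded _ (M + 1)).
apply: filterS (quasi_minimizers_le delta0 uq Fyr) => n Fnu.
by apply: MF; [rewrite ltrDl ltr01 | exists n].
Qed.

Lemma quasi_minimizers_accumulation (delta : nat -> R) (u : nat -> X) :
    reflexive_space X -> equi_coercive Fn -> delta n @[n --> \oo] --> 0%R ->
    quasi_minimizers Fn delta u ->
  weak_accumulation u `<=` minimizer F.
Proof.
move=> Xrefl Fcoer delta0 uq x ux y; rewrite leNgt; apply/negP.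
move=> /real_between[r /andP[Fyr /real_between[s /andP[rs sFx]]]].
have [M uM] := quasi_minimizers_bounded Fcoer delta0 uq (lt_trans Fyr (ltry r)).
have [k nk ukx] := eberlein_smulian Xrefl uM ux.
have Fs := gamma_liminf_subsequence nk ukx sFx.
have Fr : \forall n \near \oo, Fn (k n) (u (k n)) <= r%:E.
  exact: (infty_ge_id nk (quasi_minimizers_le delta0 uq Fyr)).
have [n [sF Fr']] := filter_ex (filterI Fs Fr).
by have := lt_le_trans rs (le_trans sF Fr'); rewrite ltxx.
Qed.

Lemma quasi_minimizers_weak_cvg (delta : nat -> R) (u : nat -> X) (x : X) :
    reflexive_space X -> equi_coercive Fn -> delta n @[n --> \oo] --> 0%R ->
    quasi_minimizers Fn delta u -> unique_minimizer F x ->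
  weak_cvg u x.
Proof.
move=> Xrefl Fcoer delta0 uq [Fx xuniq].
have [Fxy|] := ltP (F x) +oo.
  have [M uM] := quasi_minimizers_bounded Fcoer delta0 uq Fxy.
  apply: (weak_cvg_of_accumulation Xrefl uM).
  apply: subset_trans xuniq.
  exact: (quasi_minimizers_accumulation Xrefl Fcoer delta0 uq).
(* F is then constantly +oo, and uniqueness makes x the only point of X *)
rewrite leye_eq => /eqP Fxy.
have ux n : u n = x.
  apply: xuniq => z; apply: le_trans (leey _) _; rewrite -Fxy; exact: Fx.
by apply/weak_cvgP => f; under eq_fun do rewrite ux; exact: cvg_cst.
Qed.

End gamma_convergence.

(** * Penalized functionals *)

Lemma norm_cvg_weak_cvg (R : realType) (X : normedModType R) (u : nat -> X)
    (x : X) :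
  u n @[n --> \oo] --> x -> weak_cvg u x.
Proof.
move=> ux; apply/weak_cvgP => g.
exact: (cvg_comp _ _ ux (@dual_continuous _ _ g x)).
Qed.

Section penalty.
Context {R : realType} (X B : normedModType R) (gamma : {linear X -> B}).
Hypothesis gamma_continuous : continuous gamma.
Variables (A : nat -> set X) (E : X -> \bar R) (lambda : nat -> R) (p : R).
Variable f : dual X.
Hypotheses (lambda_pinfty : lambda n @[n --> \oo] --> +oo) (p_ge0 : 0 <= p).
Hypothesis E_bounded : bounded_below E.
Local Open Scope ereal_scope.

Let Fn n := penalized gamma (A n) E (lambda n) p f.
Let F := limit_functional gamma E f.

Lemma dual_comp (h : dual B) : exists g : dual X, forall x, g x = h (gamma x).
Proof.
have lhg : linear (h \o gamma : X -> R^o) by move=> a x y /=; rewrite !linearP.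
have chg : continuous (h \o gamma : X -> R^o).
  move=> x; apply: continuous_comp; first exact: gamma_continuous.
  exact: dual_continuous.
by exists (Dual (mem_set (conj lhg chg))).
Qed.

(** A functional [h] norming [gamma x] makes [h (gamma (u n))], hence
    [`|gamma (u n)|], eventually larger than [`|gamma x| / 2]; the remaining
    terms [E] and [f] are bounded from below along [u]. *)
Lemma penalized_cvg_pinfty (u : nat -> X) (x : X) :
  weak_cvg u x -> gamma x != 0%R -> Fn n (u n) @[n --> \oo] --> +oo.
Proof.
move=> /weak_cvgP ux gx; have gx0 : (0 < `|gamma x|)%R by rewrite normr_gt0.
have [h hle hgx] := norming_functional (gamma x).
have [g gE] := dual_comp h; have [C EC] := E_bounded.
pose c := (`|gamma x| / 2)%R; have c0 : (0 < c)%R by rewrite divr_gt0.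
have gu : \forall n \near \oo, (c <= `|gamma (u n)|)%R.
  have cg : (c < g x)%R by rewrite gE hgx ltr_pdivrMr// ltr_pMr// ltr1n.
  have : \forall n \near \oo, (c < g (u n))%R by exact: cvgr_gt (ux g) _ cg.
  apply: filterS => n cgn; apply: le_trans (ltW cgn) _.
  by rewrite gE (le_trans (ler_norm _))// hle.
have fu : \forall n \near \oo, (f (u n) <= f x + 1)%R.
  by apply: cvgr_le (ux f) _ _; rewrite ltrDl ltr01.
(* K makes up for the lower bound C - (f x + 1) of the other terms *)
apply/cvgeyPge => r; pose K := Num.max 0%R (r - C + (f x + 1))%R.
have lK : \forall n \near \oo, (K / c `^ p <= lambda n)%R.
  by move/cvgryPge : lambda_pinfty; exact.
near=> n; rewrite /Fn /penalized; case: ifP => // _; last by rewrite leey.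
have Kle : (K <= lambda n * `|gamma (u n)| `^ p)%R.
  have lKn : (K / c `^ p <= lambda n)%R by near: n.
  have l0 : (0 <= lambda n)%R.
    by apply: le_trans lKn; rewrite divr_ge0 ?powR_ge0// le_max lexx.
  rewrite -[leLHS](@divfK _ (c `^ p)%R) ?gt_eqF ?powR_gt0//.
  rewrite ler_pM ?powR_ge0//; first by rewrite divr_ge0 ?powR_ge0// le_max lexx.
  by rewrite ge0_ler_powR ?nnegrE ?(ltW c0)//; near: n.
have rK : (r - C + (f x + 1) <= K)%R by rewrite le_max lexx orbT.
have fun' : (f (u n) <= f x + 1)%R by near: n.
have := EC (u n); case: (E (u n)) => [e| |]; last 2 first.
- by move=> _; rewrite leey.
- by rewrite leeNy_eq.
by rewrite -EFinD !lee_fin; lra.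
Unshelve. all: by end_near. Qed.

Lemma penalized_liminf (u : nat -> X) (x : X) : weak_lsc E ->
  weak_cvg u x -> F x <= limn_einf (fun n => Fn n (u n)).
Proof.
move=> Elsc ux; have [gx|gx] := eqVneq (gamma x) 0%R; last first.
  by rewrite (cvg_limn_einf_sup (penalized_cvg_pinfty ux gx)).1 leey.
rewrite /F /limit_functional mem_set//; apply: le_limn_einf => r rF.
(* the gap s - (r + f x) absorbs the error made in replacing f (u n) by f x *)
have [s /andP[rs sE]] : exists s : R, (r + f x)%:E < s%:E < E x.
  apply: real_between; move: rF.
  by case: (E x) => [e| |] //; rewrite ?ltry// -EFinB !lte_fin ltrBrDr.
rewrite lte_fin in rs.
have Es : \forall n \near \oo, s%:E <= E (u n).
  exact: lt_limn_einf (lt_le_trans sE (Elsc x u ux)).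
have fu : \forall n \near \oo, (f (u n) <= s - r)%R.
  by move/weak_cvgP : ux => /(_ f) fux; apply: cvgr_le fux _ _; lra.
have l0 : \forall n \near \oo, (0 <= lambda n)%R.
  by move/cvgryPge : lambda_pinfty; exact.
near=> n; rewrite /Fn /penalized; case: ifP => // _; last by rewrite leey.
have fun' : (f (u n) <= s - r)%R by near: n.
have pos : (0 <= lambda n * `|gamma (u n)| `^ p)%R.
  by rewrite mulr_ge0 ?powR_ge0//; near: n.
have : s%:E <= E (u n) by near: n.
case: (E (u n)) => [e| |]; last 2 first.
- by move=> _; rewrite leey.
- by rewrite leeNy_eq.
by rewrite -EFinD !lee_fin; lra.
Unshelve. all: by end_near. Qed.

Lemma penalized_recovery (u : nat -> X) (x : X) : continuous E ->
    gamma x = 0%R -> (forall n, A n (u n)) ->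
    u n @[n --> \oo] --> x ->
    (lambda n * `|gamma (u n)| `^ p)%R @[n --> \oo] --> 0%R ->
  Fn n (u n) @[n --> \oo] --> F x.
Proof.
move=> Ec gx Au ux penalty0.
rewrite /F /limit_functional mem_set// -[E x]adde0.
under eq_fun do rewrite /Fn /penalized (mem_set (Au _)).
have fu : f (u n) @[n --> \oo] --> f x.
  by have /weak_cvgP := norm_cvg_weak_cvg ux; exact.
apply: cvgeB; first by rewrite fin_num_adde_defl.
  apply: cvgeD; first by rewrite fin_num_adde_defl.
    exact: (continuous_cvg _ (Ec x) ux).
  by apply: cvg_EFin => //; exact: nearW.
by apply: cvg_EFin => //; exact: nearW.
Qed.

Lemma penalized_gamma_cvg : weak_lsc E -> continuous E ->
    (forall x : X, gamma x = 0%R -> exists u : nat -> X,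
       [/\ forall n, A n (u n), u n @[n --> \oo] --> x &
           (lambda n * `|gamma (u n)| `^ p)%R @[n --> \oo] --> 0%R]) ->
  gamma_cvg Fn F.
Proof.
move=> Elsc Ec dense; split=> [x u|x]; first exact: penalized_liminf.
have [gx|gx] := eqVneq (gamma x) 0%R.
  have [u [Au ux penalty0]] := dense x gx.
  by exists u; [exact: norm_cvg_weak_cvg | exact: penalized_recovery].
have xx : weak_cvg (fun=> x) x by apply/weak_cvgP => g; exact: cvg_cst.
exists (fun=> x) => //; rewrite /F /limit_functional memNset.
  exact: penalized_cvg_pinfty xx gx.
exact/eqP.
Qed.

End penalty.

(** * The penalized problem over neural network classes *)

Theorem theorem7 (R : realType) (X B : completeNormedModType R)
    (X_reflexive : reflexive_space X) (B_reflexive : reflexive_space B)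
    (gamma : {linear X -> B}) (gamma_continuous : continuous gamma)
    (d m : nat) (S : function_space d m X) (rho : R -> R)
    (hidden : nat -> seq nat)
    (Theta : forall n, set (nn_param R d (hidden n) m))
    (Theta_X : forall n theta, Theta n theta ->
       exists x : X, represents S (nn_fun rho theta) x)
    (E : X -> \bar R) (E_gtNy : forall x, (-oo < E x)%E)
    (lambda : nat -> R) (lambda_pinfty : lambda n @[n --> \oo] --> +oo)
    (p : R) (p_gt1 : 1 < p) (f : dual X) :
  let A n := nn_class S rho (Theta n) in
  let X0 := gamma @^-1` [set 0] in
  let Fn n := penalized gamma (A n) E (lambda n) p f in
  let F := limit_functional gamma E f in
  (forall x : X, X0 x -> exists u : nat -> X,
     [/\ forall n, A n (u n),
         u n @[n --> \oo] --> x &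
         lambda n * `|gamma (u n)| `^ p @[n --> \oo] --> 0]) ->
  [/\ bounded_below E, weak_lsc E & continuous E] ->
  equi_coercive Fn ->
  gamma_cvg Fn F /\
  (forall (delta : nat -> R) (u : nat -> X),
     (forall n, 0 <= delta n) -> delta n @[n --> \oo] --> 0 ->
     quasi_minimizers Fn delta u ->
     [/\ (exists x : X, (F x < +oo)%E) -> bounded_set (range u),
         weak_accumulation u `<=` minimizer F &
         forall x : X, X0 x -> unique_minimizer F x -> weak_cvg u x]).
Proof.
move=> A X0 Fn F dense [E_bounded E_lsc E_continuous] Fn_coercive.
have FnF : gamma_cvg Fn F.
  by apply: penalized_gamma_cvg => //; exact: le_trans ler01 (ltW p_gt1).
split => // delta u _ delta0 u_quasi; split.
- move=> [y Fy].
  have [M uM] := quasi_minimizers_bounded FnF Fn_coercive delta0 u_quasi Fy.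
  exists M; split=> [|r Mr _ [n _ <-]]; first exact: num_real.
  exact: le_trans (uM n) (ltW Mr).
- exact: (quasi_minimizers_accumulation FnF X_reflexive Fn_coercive delta0 u_quasi).
- move=> x _ x_min.
  exact: (quasi_minimizers_weak_cvg FnF X_reflexive Fn_coercive delta0 u_quasi x_min).
Qed.
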